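(* Let $k\ge 3$ be an integer and let $G$ be a finite graph of treewidth $k$ and maximum degree $\Delta(G) \geq 3k-3$. Then the total chromatic number satisfies $\chi''(G) = \Delta(G)+1$.
   Context: Treewidth: a tree decomposition of $G$ is a tree $T$ with bags $V_t\subseteq V(G)$ ($t\in V(T)$) covering all vertices, such that each edge has both endpoints in some bag and for each vertex $v$ the set $\{t: v\in V_t\}$ induces a connected subtree of $T$; its width is the maximum bag size minus one; the treewidth of $G$ is the minimum width over all tree decompositions. The total chromatic number $\chi''(G)$ is the smallest integer $m$ such that there is an assignment of colours from a set of $m$ colours to all vertices and all edges of $G$ such that adjacent vertices receive different colours, edges sharing an endvertex receive different colours, and no edge receives the same colour as either of its endvertices. *)

(* Defs.v *)
From mathcomp Require Import all_boot.

Set Implicit Arguments.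
Unset Strict Implicit.
Unset Printing Implicit Defensive.

Record sgraph := SGraph {
  svertex :> finType;
  sedge : rel svertex;
  sedge_sym : symmetric sedge;
  sedge_irr : irreflexive sedge }.

Notation "x -- y" := (sedge x y) (at level 30).

Definition max_degree (G : sgraph) : nat := \max_(x : G) #|[set y | x -- y]|.

Definition edges (G : sgraph) : {set {set G}} :=
  [set [set p.1; p.2] | p : G * G & p.1 -- p.2].

Definition edge (G : sgraph) : finType := {E : {set G} | E \in edges G}.

Definition is_tree (T : sgraph) : Prop :=
  [/\ 0 < #|T|,
      forall s t : T, connect (@sedge T) s t
    & forall c : seq T, 2 < size c -> ~ ucycle (@sedge T) c].

Record tree_decomposition (G : sgraph) := TreeDecomposition {
  td_tree : sgraph;
  td_bag : td_tree -> {set G};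
  td_is_tree : is_tree td_tree;
  td_vertex : forall v : G, exists t, v \in td_bag t;
  td_edge : forall u v : G, u -- v ->
    exists t, (u \in td_bag t) && (v \in td_bag t);
  td_conn : forall (v : G) (s t : td_tree),
    v \in td_bag s -> v \in td_bag t ->
    connect [rel a b : td_tree | [&& a -- b, v \in td_bag a & v \in td_bag b]]
      s t }.

(* The predecessor is truncated: the graph without vertices gets width 0
   rather than -1. All other graphs have a nonempty bag. *)
Definition width (G : sgraph) (D : tree_decomposition G) : nat :=
  (\max_(t : td_tree D) #|td_bag t|).-1.

Definition has_treewidth (G : sgraph) (k : nat) : Prop :=
  (exists D : tree_decomposition G, width D = k) /\
  (forall D : tree_decomposition G, k <= width D).

Definition total_coloring (G : sgraph) (m : nat)
    (cv : G -> 'I_m) (ce : edge G -> 'I_m) : bool :=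
  [&& [forall x : G, forall y : G, (x -- y) ==> (cv x != cv y)],
      [forall e : edge G, forall f : edge G,
        (e != f) && ~~ [disjoint val e & val f] ==> (ce e != ce f)]
    & [forall x : G, forall e : edge G, (x \in val e) ==> (cv x != ce e)]].

Definition total_colorable (G : sgraph) (m : nat) : bool :=
  [exists cv : {ffun G -> 'I_m}, exists ce : {ffun edge G -> 'I_m},
    total_coloring cv ce].

Lemma ex_total_colorable (G : sgraph) : exists m, total_colorable G m.
Proof.
exists #|{: G + edge G}|; apply/existsP.
exists [ffun x => enum_rank (inl x : G + edge G)]; apply/existsP.
exists [ffun e => enum_rank (inr e : G + edge G)].
apply/and3P; split; apply/forallP => x; apply/forallP => y; apply/implyP;
  rewrite !ffunE (inj_eq enum_rank_inj) //.
- by move=> xy; apply: contraTneq xy => -[->]; rewrite sedge_irr.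
- by case/andP=> xy _; apply: contraNneq xy => -[->].
Qed.

Definition total_chromatic_number (G : sgraph) : nat :=
  ex_minn (ex_total_colorable G).

(* Main.v *)
(* Put D = Delta(G) and colour with D + 1 colours, by induction on the number of
   edges. If an edge uv has deg u <= D/2 and deg u + deg v <= D + 1, colour the
   graph without uv, uncolour u, and extend greedily. Otherwise vertices of
   degree at most D/2 are adjacent only to vertices of larger degree. Root the
   decomposition tree, let w be a vertex of degree > D/2 whose topmost bag B is
   as deep as possible, and put X = B - w, U = N(w) - X. Every u in U has degree
   at most D/2 and N(u) is contained in B, so deg u <= k; moreover U is nonempty
   because k >= 3. By induction, all can be coloured except one edge wu and the
   vertices in U, which can be coloured last. Let a be a colour missing at w.
   Counting as in Vizing's fans, D >= 3k - 3 is just enough to force that either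
   the colouring can be completed, or every x in X has c(wx) missing at u and
   some u' in U has an edge u'x coloured a, with x in X and c(wu') missing at u.
   Giving wu the colour of wu', uncolouring wu', and counting again, one sees
   that m = c(wx) is missing at u' as well. Then, in the original colouring,
   recolour wx with a and u'x with m, and colour wu with m. *)

Require Import Defs.
From mathcomp Require Import all_boot.
From mathcomp Require Import zify.

Set Implicit Arguments.
Unset Strict Implicit.
Unset Printing Implicit Defensive.

(** * Edge deletion on a fixed vertex set *)

Definition delete_edge (V : eqType) (e : rel V) (a b : V) : rel V :=
  fun x y => e x y && ~~ ((x == a) && (y == b) || (x == b) && (y == a)).

Lemma delete_edge_sym (V : eqType) (e : rel V) (a b : V) :
  symmetric e -> symmetric (delete_edge e a b).
Proof.
by move=> sym x y; rewrite /delete_edge sym orbC [(y == b) && _]andbC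
  [(y == a) && _]andbC.
Qed.

Lemma delete_edgeC (V : eqType) (e : rel V) (a b x y : V) :
  delete_edge e a b x y = delete_edge e b a x y.
Proof. by rewrite /delete_edge orbC. Qed.

(** * Rooting the decomposition tree *)

Section RootedTree.

Variable T : sgraph.
Hypothesis tree : is_tree T.

(** A simple path avoiding the edge would close up with it to a cycle of length at least three. *)
Lemma tree_bridge (s t : T) :
  s -- t -> ~~ connect (delete_edge (@sedge T) s t) s t.
Proof.
move=> st; apply/negP => /connectP[p0 path0 last0].
move: path0 last0; case/shortenP => p path_p uniq_p _ last_p.
case: tree => _ _ acyclic; apply: (acyclic (s :: p)).
  case: p path_p last_p {uniq_p} => [_ /= ts|y [|z p] //= path_p ty].
    by rewrite ts sedge_irr in st.
  by move: path_p; rewrite ty /delete_edge !eqxx andbF.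
rewrite /ucycle uniq_p /= rcons_path -last_p sedge_sym st andbT andbT.
by apply: sub_path path_p => x y /andP[].
Qed.

(** [d] is the distance from [r]; the penultimate vertex of a shortest walk from [r] to [t] shows
    that a closer neighbour exists. *)
Lemma tree_parent : exists (r : T) (d : T -> nat) (p : T -> T),
  forall t, t != r -> (t -- p t) && (d (p t) < d t).
Proof.
case: tree => /card_gt0P[r _] conn _.
pose P t n := [exists q : n.-tuple T, path (@sedge T) r q && (last r q == t)].
have exP t : exists n, P t n.
  have /connectP[q path_q last_q] := conn r t.
  exists (size q); apply/existsP; exists (in_tuple q).
  by rewrite path_q -last_q /=.
pose d t := ex_minn (exP t).
have closer t : exists s, (t != r) ==> (t -- s) && (d s < d t).
  rewrite {2}/d; case: ex_minnP => n /existsP[q /andP[path_q /eqP last_q]] _.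
  case: n q path_q last_q => [q _|n].
    by rewrite (tuple0 q) /= => <-; exists r; rewrite eqxx.
  case; case/lastP=> [|q s] //= size_q; rewrite rcons_path last_rcons.
  case/andP=> path_q q_s s_t.
  exists (last r q); apply/implyP => _; rewrite -s_t sedge_sym q_s ltnS /=.
  rewrite /d; case: ex_minnP => m _; apply; apply/existsP.
  rewrite size_rcons eqSS in size_q.
  by exists (Tuple size_q); rewrite /= path_q eqxx.
exists r, d, (fun t => xchoose (closer t)) => t.
exact/implyP/(xchooseP (closer t)).
Qed.

End RootedTree.

(* [top v] is the node closest to the root among those whose bag contains [v],
   and [d v] is its depth. *)
Lemma td_top (G : sgraph) (D : tree_decomposition G) :
  exists (top : G -> td_tree D) (d : G -> nat),
    (forall v, v \in td_bag (top v)) /\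
    (forall (s : td_tree D) u v, u \in td_bag s -> v \in td_bag s ->
      d v <= d u -> v \in td_bag (top u)).
Proof.
have [r [d [p parent]]] := tree_parent (td_is_tree D).
have exmin v : exists t, [&& v \in td_bag t &
    [forall s : td_tree D, (v \in td_bag s) ==> (d t <= d s)]].
  have [t0 vt0] := td_vertex D v.
  case: (@arg_minnP _ t0 (fun t => v \in td_bag t) d vt0) => t vt tmin.
  by exists t; rewrite vt; apply/forallP => s; apply/implyP => /tmin.
pose top v := xchoose (exmin v).
have vtop v : v \in td_bag (top v) by case/andP: (xchooseP (exmin v)).
have top_min v s : v \in td_bag s -> d (top v) <= d s.
  by case/andP: (xchooseP (exmin v)) => _ /forallP/(_ s)/implyP.
(* Climbing from [x] never meets [s], because all later nodes are shallower than [s]; so the climb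
   avoids the edge from [s] to its parent. *)
have to_root s n x : d x < n -> d x <= d s -> x != s -> s != r ->
    connect (delete_edge (@sedge (td_tree D)) s (p s)) x r.
  elim: n x => // n IHn x; rewrite ltnS => dx xs x_s s_r.
  have [-> //|x_r] := eqVneq x r.
  have /andP[xp dp] := parent x x_r.
  have p_s : p x != s by apply: contraTneq dp => ->; rewrite -leqNgt.
  apply: connect_trans (connect1 _) (IHn (p x) _ _ p_s s_r); last 2 first.
  - exact: leq_trans dp dx.
  - exact: ltnW (leq_trans dp xs).
  by rewrite /delete_edge xp (negPf x_s) (negPf p_s) andbF.
(* If the bag of [p s] missed [v], the nodes containing [v] would join [s] to [top v] without the
   edge from [s] to [p s]. Climbs from [top v] and from [p s] to [r] would then complete a detour
   around a bridge. *)
have climb v s : v \in td_bag s -> s != top v ->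
    (s != r) && (v \in td_bag (p s)).
  move=> vs s_top.
  have s_r : s != r.
    apply: contraNneq s_top => s_r.
    have [->|top_r] := eqVneq (top v) r; first by rewrite s_r.
    (* The root has least depth, so [top v], being no deeper than [s = r], cannot differ from it. *)
    have lower : forall n x, d x < n -> d r <= d x.
      elim=> // n IHn x; rewrite ltnS => dx.
      have [-> //|x_r] := eqVneq x r.
      have /andP[_ dp] := parent x x_r.
      exact: leq_trans (IHn _ (leq_trans dp dx)) (ltnW dp).
    have /andP[_ dp] := parent _ top_r.
    have := leq_ltn_trans (lower _ _ (ltnSn _)) dp.
    by rewrite ltnNge -s_r top_min.
  rewrite s_r /=; apply: contraT => vps.
  have /andP[sp dps] := parent s s_r.
  have /negP[] := tree_bridge (td_is_tree D) sp.
  apply: (@connect_trans _ _ (top v)).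
    apply: connect_sub (td_conn vs (vtop v)) => a b /and3P[ab va vb].
    apply: connect1; rewrite /delete_edge ab /=.
    by apply/norP; split; apply/negP => /andP[/eqP ? /eqP ?]; subst;
      move: vps; rewrite ?va ?vb.
  apply: (@connect_trans _ _ r).
    by apply: (to_root s _ _ (ltnSn _)); rewrite ?top_min // eq_sym.
  rewrite (sym_connect_sym (delete_edge_sym _ _ (@sedge_sym _))).
  apply: (to_root s _ _ (ltnSn _)); rewrite ?(ltnW dps) //.
  by apply: contraTneq dps => ->; rewrite ltnn.
exists top, (d \o top); split=> // s u v; rewrite /=.
(* Move [s] up, keeping both vertices in its bag, until it is [top u]. Meeting [top v] first would
   put [u] in a bag above [top v], against [duv]. *)
have [n] := ubnP (d s); elim: n s => // n IHn s; rewrite ltnS => dsn us vs duv.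
have [<- //|s_u] := eqVneq s (top u).
have /andP[s_r ups] := climb _ _ us s_u.
have /andP[_ dps] := parent s s_r.
have [s_v|s_v] := eqVneq s (top v).
  have := leq_ltn_trans (leq_trans duv (top_min _ _ ups)) dps.
  by rewrite s_v ltnn.
have /andP[_ vps] := climb _ _ vs s_v.
exact: IHn (leq_trans dps dsn) ups vps duv.
Qed.

(** * Partial total colourings and their greedy extension *)

Section PartialColouring.

Variables V C : finType.
Implicit Types (e : rel V) (f : V -> V -> option C) (a b x y : V) (c : C).

(* [f x y] colours the edge [x y], and [f x x] the vertex [x]. *)
Record partial_colouring e f : Prop := PartialColouring {
  pc_sym : forall x y, f x y = f y x;
  pc_inj : forall x y z c, f x y = Some c -> f x z = Some c -> y = z;
  pc_vertex : forall x y c, e x y -> f x x = Some c -> f y y <> Some c }.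

(* Exactly the vertices in [U] are uncoloured. *)
Definition coloured_except e (U : {set V}) f : Prop :=
  partial_colouring e f /\
  forall x y, f x y = e x y || (x == y) && (x \notin U) :> bool.

(** The case [y = x] makes the colour of the vertex [x] itself count as present. *)
Definition missing f x : {set C} := [set c | [forall y, f x y != Some c]].

(** Taking [a = b] recolours a vertex, so edges and vertices share one update. *)
Definition upd f a b (o : option C) : V -> V -> option C :=
  fun x y => if (x == a) && (y == b) || (x == b) && (y == a) then o else f x y.

Lemma missingP f x c : reflect (forall y, f x y <> Some c) (c \in missing f x).
Proof. by rewrite inE; apply: (iffP forallP) => H y; apply/eqP. Qed.

Lemma not_missing f x c : c \notin missing f x -> exists y, f x y = Some c.
Proof.
by rewrite inE negb_forall => /existsP[y]; rewrite negbK => /eqP; exists y.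
Qed.

Lemma card_present f x : #|~: missing f x| <= #|[set y | f x y]|.
Proof.
have someI : injective (@Some C) by move=> c c' [].
rewrite -(card_imset _ someI).
apply: leq_trans (leq_imset_card (f x) _); apply: subset_leq_card.
apply/subsetP=> _ /imsetP[c + ->]; rewrite !inE negb_forall => /existsP[y].
by rewrite negbK => /eqP fxy; apply/imsetP; exists y; rewrite ?inE fxy.
Qed.

Lemma card_missing f x : #|C| <= #|missing f x| + #|[set y | f x y]|.
Proof. by rewrite -(cardsC (missing f x)) leq_add2l card_present. Qed.

Lemma upd_other f a b o x y : x != a -> x != b -> upd f a b o x y = f x y.
Proof. by rewrite /upd => /negPf-> /negPf->. Qed.

Lemma missing_upd f a b o x c :
  o != Some c -> c \in missing f x -> c \in missing (upd f a b o) x.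
Proof.
move=> oc /missingP fxc; apply/missingP => y; rewrite /upd.
by case: ifP => _ //; apply/eqP.
Qed.

Lemma missing_upd_other f a b o x c :
  x != a -> x != b -> c \in missing f x -> c \in missing (upd f a b o) x.
Proof.
move=> xa xb /missingP fxc; apply/missingP => y.
by rewrite upd_other //; apply: fxc.
Qed.

Lemma missing_upd_same e f a b o c : partial_colouring e f ->
  f a b = Some c -> o != Some c -> c \in missing (upd f a b o) a.
Proof.
move=> pc fab oc; apply/missingP => y; rewrite /upd eqxx.
case: ifP => [_|]; first by apply/eqP.
by case: eqVneq => // yb _ /(pc_inj pc fab) => /esym/eqP; rewrite (negPf yb).
Qed.

Lemma upd_sym f a b o x y : upd f a b o x y = upd f b a o x y.
Proof. by rewrite /upd orbC. Qed.

Lemma missing_upd_sym f a b o x :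
  missing (upd f a b o) x = missing (upd f b a o) x.
Proof.
by apply/setP => c; rewrite !inE; apply: eq_forallb => y; rewrite upd_sym.
Qed.

Lemma partial_colouring_clear e f a b :
  partial_colouring e f -> partial_colouring e (upd f a b None).
Proof.
move=> pc; split=> [x y|x y z c|x y c exy]; rewrite /upd.
- by rewrite (pc_sym pc) orbC [(y == b) && _]andbC [(y == a) && _]andbC.
- by case: ifP => // _ fxy; case: ifP => // _; apply: (pc_inj pc fxy).
- by case: ifP => // _ fxx; case: ifP => // _; apply: (pc_vertex pc exy fxx).
Qed.

(** The last two hypotheses concern [a = b]: a vertex is then coloured, and its neighbours must not
    bear [c]. *)
Lemma partial_colouring_upd e f a b c :
    partial_colouring e f -> c \in missing f a -> c \in missing f b ->
    symmetric e -> (a = b -> ~~ e a a) ->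
    (a = b -> forall y, e a y -> f y y <> Some c) ->
  partial_colouring e (upd f a b (Some c)).
Proof.
move=> pc /missingP fa /missingP fb sym irr loop.
split=> [x y|x y z c'|x y c' exy]; rewrite /upd.
- by rewrite (pc_sym pc) orbC [(y == b) && _]andbC [(y == a) && _]andbC.
- case: ifP => [xy [<-]|xy fxy]; case: ifP => [xz|xz].
  + by case/orP: xy => /andP[/eqP ? /eqP ?];
      case/orP: xz => /andP[/eqP ? /eqP ?]; subst.
  + by case/orP: xy => /andP[/eqP-> _] => [/fa|/fb].
  + by move=> [cc]; subst; case/orP: xz fxy => /andP[/eqP-> _] => [/fa|/fb].
  + exact: (pc_inj pc fxy).
- case: ifP => [/orP xx [<-]|_ fxx]; case: ifP => [/orP yy|_].
  + by case: xx => /andP[/eqP ? /eqP ?]; case: yy => /andP[/eqP ? /eqP ?];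
      subst; have /negP := irr erefl; rewrite exy.
  + case: xx => /andP[/eqP ? /eqP ?]; subst; exact: loop.
  + move=> [cc]; subst; case: yy => /andP[/eqP ? /eqP ?]; subst;
    by rewrite sym in exy; apply: (loop erefl _ exy).
  + exact: (pc_vertex pc exy fxx).
Qed.

Lemma colour_edge e (U : {set V}) f a b c :
    symmetric e -> irreflexive e -> partial_colouring e f ->
    (forall x y,
      f x y = delete_edge e a b x y || (x == y) && (x \notin U) :> bool) ->
    e a b -> c \in missing f a -> c \in missing f b ->
  coloured_except e U (upd f a b (Some c)).
Proof.
move=> sym irr pc dom ab ca cb; split.
  apply: partial_colouring_upd => // [_|E]; first by rewrite irr.
  by rewrite -E irr in ab.
move=> x y; rewrite /upd; case: ifP => [xy|xy].
  by case/orP: xy => /andP[/eqP-> /eqP->]; rewrite ?(sym b) ab.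
by rewrite dom /delete_edge xy andbT.
Qed.

(** Erasing the colours of [U] uncolours the end [u] of the deleted edge, so restoring this edge
    creates no conflict between its ends. *)
Lemma uncolour_vertices e (U : {set V}) u v g :
    symmetric e -> irreflexive e -> u \in U ->
    coloured_except (delete_edge e u v) set0 g ->
  exists f, partial_colouring e f /\
    forall x y,
      f x y = delete_edge e u v x y || (x == y) && (x \notin U) :> bool.
Proof.
move=> sym irr uU [pc dom].
exists (fun x y => if (x == y) && (x \in U) then None else g x y).
split; last first.
  move=> x y; case: eqVneq => [<-|xy] /=; last by rewrite dom (negPf xy).
  by rewrite /delete_edge irr; case: ifP => //= xU; rewrite dom eqxx inE orbT.
split=> [x y|x y z c|x y c exy].
- by rewrite (pc_sym pc) eq_sym; case: eqVneq => // ->.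
- by case: ifP => // _ gxy; case: ifP => // _; apply: (pc_inj pc gxy).
rewrite !eqxx /=; case: ifP => // xU gxx; case: ifP => // yU.
apply: (pc_vertex pc _ gxx); rewrite /delete_edge exy /=.
by apply/norP; split; apply/negP => /andP[/eqP ? /eqP ?]; subst;
  rewrite ?uU in xU yU.
Qed.

(** Greedy: the edges at [u] and its neighbours forbid at most twice the degree of [u] many
    colours. *)
Lemma colour_vertices e (U : {set V}) f :
    symmetric e -> irreflexive e -> coloured_except e U f ->
    (forall u, u \in U -> 2 * #|[set y | e u y]| < #|C|) ->
  exists g, coloured_except e set0 g.
Proof.
move=> sym irr; have [n] := ubnP #|U|.
elim: n U f => // n IHn U f; rewrite ltnS => Un [pc dom] small.
have [U0|[u uU]] := set_0Vmem U; first by exists f; rewrite -U0.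
have fuu : f u u = None by have := dom u u; rewrite irr uU andbF; case: (f u u).
pose N := [set y | e u y].
pose S := [set c | Some c \in (f u @: N) :|: ((fun y => f y y) @: N)].
have someI : injective (@Some C) by move=> c c' [].
have SC : #|S| < #|C|.
  apply: leq_ltn_trans (small u uU); rewrite -(card_imset _ someI) mul2n -addnn.
  apply: leq_trans (leq_add (leq_imset_card (f u) N)
    (leq_imset_card (fun y => f y y) N)).
  apply: leq_trans (leq_card_setU _ _); apply: subset_leq_card.
  by apply/subsetP=> _ /imsetP[c + ->]; rewrite inE.
have /card_gt0P[c] : 0 < #|~: S| by rewrite -(ltn_add2l #|S|) cardsC addn0.
rewrite !inE => /norP[c1 c2].
have cu : c \in missing f u.
  apply/missingP => y fuy; case/negP: c1; apply/imsetP; exists y => //.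
  by rewrite inE; have := dom u y; rewrite fuy uU andbF orbF => <-.
apply: (IHn (U :\ u) (upd f u u (Some c))).
- by rewrite (cardsD1 u) uU in Un.
- split.
    apply: partial_colouring_upd => // [_|_ y uy fyy]; first by rewrite irr.
    by case/negP: c2; apply/imsetP; exists y; rewrite ?inE.
  move=> x y; rewrite /upd orbb; case: ifP => [/andP[/eqP-> /eqP->]|xy].
    by rewrite !inE eqxx orbT.
  rewrite dom !inE; congr (_ || _); apply: andb_id2l => /eqP xy'.
  by move: xy; rewrite -xy' andbb => ->.
by move=> x /setD1P[_ /small].
Qed.

(** With [u] and the edge uncoloured, fewer than deg u colours occur at [u] and at most deg v at
    [v]. Hence some colour is missing at both; it goes to the edge, and [u] is coloured greedily
    afterwards. *)
Lemma colour_low_edge e u v g :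
    symmetric e -> irreflexive e -> e u v ->
    2 * #|[set y | e u y]| < #|C| ->
    #|[set y | e u y]| + #|[set y | e v y]| <= #|C| ->
    coloured_except (delete_edge e u v) set0 g ->
  exists g', coloured_except e set0 g'.
Proof.
move=> sym irr uv small deg_uv col.
have [f [pc dom]] := uncolour_vertices sym irr (set11 u) col.
have card_u : #|[set y | f u y]| < #|[set y | e u y]|.
  apply: proper_card; apply/properP; split.
    apply/subsetP => y; rewrite !inE dom inE eqxx andbF orbF.
    by case/andP.
  exists v; rewrite !inE // dom /delete_edge !eqxx inE eqxx.
  by rewrite !andbF.
have card_v : #|[set y | f v y]| <= #|[set y | e v y]|.
  (* The uncoloured edge to [u] offsets the colour of [v] itself. *)
  have -> : #|[set y | e v y]| = #|v |: ([set y | e v y] :\ u)|.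
    rewrite cardsU1 !inE irr andbF /= (cardsD1 u [set y | e v y]).
    by rewrite inE sym uv.
  apply: subset_leq_card; apply/subsetP => y.
    rewrite !inE dom /delete_edge !eqxx.
  case/orP=> [/andP[-> /norP[_ /= yu]]|/andP[/eqP->]]; last by rewrite eqxx.
  by rewrite yu orbT.
have [c cu cv] : exists2 c, c \in missing f u & c \in missing f v.
  suff /card_gt0P[c] : 0 < #|missing f u :&: missing f v|.
    by rewrite inE => /andP[]; exists c.
  have := cardsC (missing f u :&: missing f v).
  have [+ _] := leq_card_setU (~: missing f u) (~: missing f v).
  rewrite -setCI; have := card_present f u; have := card_present f v; lia.
apply: (@colour_vertices e [set u] (upd f u v (Some c))) => //.
  exact: colour_edge.
by move=> x /set1P->.
Qed.

End PartialColouring.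

(** * Recolouring around a vertex [w] *)

Section Recolouring.

Variables (V C : finType) (e : rel V) (w : V) (X : {set V}) (k : nat).
Hypotheses (e_sym : symmetric e) (e_irr : irreflexive e).
Let U := [set u | e w u] :\: X.
Hypothesis w_X : w \notin X.
Hypothesis nbr_U : forall u y, u \in U -> e u y -> y \in w |: X.
Hypothesis deg_U : forall u, u \in U -> #|[set y | e u y]| <= k.
Hypothesis card_X : #|X| <= k.
Hypothesis deg_w : #|[set y | e w y]| < #|C|.
Hypothesis k_ge3 : 3 <= k.
Hypothesis card_C : 3 * k - 2 <= #|C|.
Implicit Types (f : V -> V -> option C) (u x y : V).

(* Exactly the edge [w u] and the vertices in [U] are uncoloured. *)
Definition coloured_but f u : Prop :=
  [/\ partial_colouring e f, u \in U
    & forall x y,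
        f x y = delete_edge e w u x y || (x == y) && (x \notin U) :> bool].

Lemma U_adj u : u \in U -> e w u.
Proof. by rewrite !inE => /andP[]. Qed.

Lemma U_neq_w u : u \in U -> u != w.
Proof. by move/U_adj; apply: contraTneq => ->; rewrite e_irr. Qed.

Lemma w_U : w \notin U.
Proof. by rewrite !inE e_irr andbF. Qed.

Lemma X_neq_w x : x \in X -> x != w.
Proof. by apply: contraTneq => ->. Qed.

Lemma X_notin_U x : x \in X -> x \notin U.
Proof. by rewrite !inE => ->. Qed.

Lemma X_neq_U x u : x \in X -> u \in U -> x != u.
Proof. by move/X_notin_U => xU uU; apply: contraNneq xU => ->. Qed.

Lemma coloured_but_wu f u : coloured_but f u -> f w u = None.
Proof.
case=> _ uU dom; have := dom w u; rewrite /delete_edge !eqxx andbF /=.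
by rewrite eq_sym (negPf (U_neq_w uU)); case: (f w u).
Qed.

Lemma coloured_but_finish f u c : coloured_but f u ->
  c \in missing f w -> c \in missing f u ->
  coloured_except e U (upd f w u (Some c)).
Proof.
by case=> pc uU dom cw cu; apply: colour_edge => //; apply: U_adj.
Qed.

(** The shift of a Vizing fan: [c] moves from [w u'] to [w u], which frees it at [u']. Both
    inclusions of the last equality matter: one offers colours for [w u'], the other brings
    information back to [f]. *)
Lemma coloured_but_shift f u u' c : coloured_but f u ->
    u' \in U -> f w u' = Some c -> c \in missing f u ->
  exists g, [/\ coloured_but g u', missing f w \subset missing g w,
    forall x, x \in X -> g w x = f w x
    & missing g u' = c |: missing f u'].
Proof.
move=> st u'U fwu' cu; have fwu := coloured_but_wu st.
case: st => pc uU dom; have /negPf uw := U_neq_w uU.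
have /negPf u'w := U_neq_w u'U.
have u_u' : u != u' by apply/eqP => E; rewrite E fwu' in fwu.
have cw : c \in missing (upd f w u' None) w.
  exact: (missing_upd_same pc).
exists (upd (upd f w u' None) w u (Some c)); split.
- split=> //.
    apply: partial_colouring_upd => //; first exact: partial_colouring_clear.
    + exact: missing_upd.
    + by rewrite e_irr.
    + by move=> E; rewrite E eqxx in uw.
  move=> x y; rewrite /upd; case: ifP => [xy|xy]; last first.
    case: ifP => [xy'|xy'].
      by rewrite /delete_edge xy' andbF; case/orP: xy' => /andP[/eqP-> /eqP->];
        rewrite ?u'w // eq_sym u'w.
    by rewrite dom /delete_edge xy xy'.
  rewrite /delete_edge; case/orP: xy => /andP[/eqP-> /eqP->];
  by rewrite ?(e_sym u) (U_adj uU) uw (negPf u_u') ?andbF ?eqxx.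
- apply/subsetP => d dw; apply: missing_upd; last exact: missing_upd.
  by apply: contraTneq dw => -[<-]; apply/negP => /missingP/(_ _ fwu').
- move=> x xX; have /negPf xu := X_neq_U xX uU.
  have /negPf xu' := X_neq_U xX u'U.
  by rewrite /upd xu xu' (negPf (X_neq_w xX)) !andbF.
apply/setP => d; rewrite in_setU1.
apply/missingP/orP => [d_g|[/eqP->|/missingP d_f] y].
- have [|dc] := eqVneq d c; [by left | right]; apply/missingP => y fy.
  apply: (d_g y); have yw : y != w.
  by apply: contraNneq dc => yw; move: fy; rewrite yw (pc_sym pc) fwu' => -[->].
  by rewrite /upd u'w (negPf yw) !andbF.
- apply/missingP: y; apply: missing_upd_other; rewrite ?u'w 1?eq_sym //.
  rewrite missing_upd_sym.
  by apply: (missing_upd_same pc); rewrite // (pc_sym pc).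
- apply/missingP: y; apply: missing_upd_other; rewrite ?u'w 1?eq_sym //.
  by apply: missing_upd => //; apply/missingP.
Qed.

(** Recolouring [w] with [a] frees [c] for the edge [w u]. The neighbours of [w] do not object:
    those in [U] are uncoloured and those in [X] avoid [a]. *)
Lemma coloured_but_recolour_w f u a c : coloured_but f u ->
    a \in missing f w -> f w w = Some c -> c \in missing f u ->
    (forall x, x \in X -> f x x <> Some a) ->
  exists g : V -> V -> option C, coloured_except e U g.
Proof.
move=> st aw fww cu noX; case: (st) => pc uU dom.
have uw := U_neq_w uU.
exists (upd (upd f w w (Some a)) w u (Some c)).
apply: coloured_but_finish; last first.
- by apply: missing_upd_other.
- apply: (missing_upd_same pc) => //.
  by apply: contraTneq aw => -[->]; apply/negP => /missingP/(_ _ fww).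
split=> //.
  apply: partial_colouring_upd => // [_|_ y wy]; first by rewrite e_irr.
  have [yX|yX] := boolP (y \in X); first exact: noX.
  have yU : y \in U by rewrite !inE yX.
  have := dom y y; rewrite /delete_edge e_irr yU /= andbF.
  by case: (f y y).
move=> x y; rewrite /upd orbb.
case: ifP => [/andP[/eqP-> /eqP->]|_]; last exact: dom.
by rewrite eqxx w_U orbT.
Qed.

(** Clearing [u' x] frees [a] at [x], so [w x] can change from [c] to [a]. This frees [c] at both
    [w] and [x], for use on [w u] and [u' x]. *)
Lemma coloured_but_swap f u u' x a c : coloured_but f u ->
    a \in missing f w -> u' \in U -> u' != u -> x \in X ->
    f u' x = Some a -> f w x = Some c -> c \in missing f u ->
    c \in missing f u' ->
  exists g : V -> V -> option C, coloured_except e U g.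
Proof.
move=> st aw u'U u'u xX fu'x fwx cu cu'; case: (st) => pc uU dom.
have uw := U_neq_w uU; have u'w := U_neq_w u'U; have xw := X_neq_w xX.
have xu := X_neq_U xX uU; have xu' := X_neq_U xX u'U.
have ac : Some a != Some c.
  by apply/eqP => -[E]; move/missingP/(_ x): aw; rewrite fwx E => /(_ erefl).
have wu : w != u by rewrite eq_sym.
have wu' : w != u' by rewrite eq_sym.
have ux : u != x by rewrite eq_sym.
have u'x : u' != x by rewrite eq_sym.
have wx : w != x by rewrite eq_sym.
have uu' : u != u' by rewrite eq_sym.
(* Both edges are cleared before either is recoloured, which keeps every intermediate colouring
   proper. *)
pose f1 := upd f u' x None.
have pc1 : partial_colouring e f1 by apply: partial_colouring_clear.
have f1wx : f1 w x = Some c by rewrite /f1 upd_other.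
pose f2 := upd f1 w x None.
have pc2 : partial_colouring e f2 by apply: partial_colouring_clear.
pose f3 := upd f2 w x (Some a).
have ax : a \in missing f2 x.
  apply: missing_upd => //; rewrite /f1 missing_upd_sym.
  by apply: (missing_upd_same pc); rewrite // (pc_sym pc).
have cw : c \in missing f2 w by apply: (missing_upd_same pc1).
have cx : c \in missing f2 x.
  rewrite /f2 missing_upd_sym.
  by apply: (missing_upd_same pc1); rewrite // (pc_sym pc1).
have pc3 : partial_colouring e f3.
  apply: partial_colouring_upd => //; last 2 first.
  - by move=> E; rewrite E eqxx in xw.
  - by move=> E; rewrite E eqxx in xw.
  by do 2 apply: missing_upd => //.
pose f4 := upd f3 u' x (Some c).
have pc4 : partial_colouring e f4.
  apply: partial_colouring_upd => //.
  - by do 2 (apply: missing_upd_other => //); apply: missing_upd.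
  - by apply: missing_upd => //.
  - by move=> E; rewrite E eqxx in xu'.
  - by move=> E; rewrite E eqxx in xu'.
exists (upd f4 w u (Some c)); apply: coloured_but_finish; last first.
- by do 3 (apply: missing_upd_other => //); apply: missing_upd.
- by apply: missing_upd_other => //; apply: missing_upd.
have e_u'x : e u' x.
  have := dom u' x; rewrite fu'x (negPf u'x) orbF => /esym.
  by case/andP.
have e_wx : e w x.
  have := dom w x; rewrite fwx (negPf wx) orbF => /esym.
  by case/andP.
split=> // y z; rewrite /f4 /f3 /f2 /f1 /upd; case: ifP => [yz|yz1].
  case/orP: yz => /andP[/eqP-> /eqP->]; rewrite /delete_edge ?(e_sym x) e_u'x;
  by rewrite (negPf xu) (negPf u'u) (negPf xw) (negPf u'w) ?andbF.
case: ifP => [yz|yz2]; last by rewrite yz2 yz1 dom.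
case/orP: yz => /andP[/eqP-> /eqP->]; rewrite /delete_edge ?(e_sym x) e_wx;
by rewrite (negPf xu) (negPf xw) (negPf wu) ?andbF.
Qed.

(* Counting the colours missing at [u]: they all occur at [w], either on [w]
   itself, or towards [X], or towards the vertices of [U] that [u] could be
   shifted to; each of the latter, and [u], has an [a]-edge to [X]. *)
Lemma coloured_but_tight f u a : coloured_but f u -> a \in missing f w ->
  (exists g : V -> V -> option C, coloured_except e U g) \/
  [/\ forall x, x \in X -> exists2 c, f w x = Some c & c \in missing f u
    & exists u' x c, [/\ u' \in U, x \in X, f u' x = Some a, f w u' = Some c
        & c \in missing f u]].
Proof.
move=> st aw; case: (st) => pc uU dom; have uw := U_neq_w uU.
have fwu := coloured_but_wu st.
pose M := missing f u.
pose F := [set u' in U | [exists c in M, f w u' == Some c]].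
have [/existsP[c /andP[cw cu]]|] :=
  boolP [exists c, (c \in missing f w) && (c \in M)].
  by left; exists (upd f w u (Some c)); apply: coloured_but_finish.
rewrite negb_exists => /forallP noM.
(* If [a] is missing at some [u'] in [F], shift to [u'] and colour [w u'] with [a]. *)
have [/existsP[u' /andP[]]|] :=
  boolP [exists u', (u' \in F) && (a \in missing f u')].
  rewrite inE => /andP[u'U /exists_inP[c cM /eqP fwu']] au'; left.
  have [g [st' sub_w _ sub_u']] := coloured_but_shift st u'U fwu' cM.
  exists (upd g w u' (Some a)); apply: coloured_but_finish => //.
    exact: subsetP aw.
  by rewrite sub_u' in_setU1 au' orbT.
rewrite negb_exists => /forallP noF.
have F_U u' : u' \in u |: F -> u' \in U.
  by rewrite !in_setU1 => /predU1P[->//|]; rewrite inE => /andP[].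
(* The vertex [u'] is uncoloured and [a] is missing at [w], so the [a] at [u'] can only be on an
   edge to [X]. *)
have edge_a u' : u' \in u |: F -> exists2 x, x \in X & f u' x = Some a.
  move=> u'F; have u'U := F_U _ u'F.
  have [|y fy] := @not_missing _ _ f u' a.
    move: u'F; rewrite in_setU1 => /predU1P[->|u'F].
      by have := noM a; rewrite aw.
    by have := noF u'; rewrite u'F.
  exists y => //; have := dom u' y.
  rewrite fy u'U andbF orbF => /esym/andP[u'y _].
  have /setU1P[yw|//] := nbr_U u'U u'y.
  by move/missingP/(_ u'): aw; rewrite -yw (pc_sym pc).
pose A := [set x in X | f x x != Some a].
(* The [a]-edges from [u] and from [F] end at distinct vertices of [X], none of them coloured [a].
   The default [w] of [h] is never taken there. *)
have card_F : #|F|.+1 <= #|A|.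
  pose h u' := odflt w [pick x in X | f u' x == Some a].
  have hP u' : u' \in u |: F -> h u' \in X /\ f u' (h u') = Some a.
    move=> /edge_a[x xX fx]; rewrite /h; case: pickP => [y /andP[yX /eqP]//|].
    by move/(_ x); rewrite xX fx eqxx.
  have -> : #|F|.+1 = #|u |: F|.
    rewrite cardsU1 inE uU /=; case: exists_inP => // -[c _].
    by rewrite fwu.
  rewrite -(card_in_imset (f := h)) => [|u1 u2 /hP[_ h1] /hP[_ h2] E].
    apply: subset_leq_card; apply/subsetP => _ /imsetP[u' u'F ->].
    have [hX fh] := hP _ u'F; rewrite inE hX; apply/eqP => fhh.
    have E : u' = h u' by apply: (pc_inj pc _ fhh); rewrite (pc_sym pc).
    by have := X_neq_U hX (F_U _ u'F); rewrite -E eqxx.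
  by apply: (pc_inj pc (x := h u1) (c := a)); rewrite (pc_sym pc) // E.
(* [w] belongs to [Y] when its own colour lies in [M]. *)
pose Y := [set y | [exists c in M, f w y == Some c]].
have card_M : #|M| <= #|Y|.
  have someI : injective (@Some C) by move=> c c' [].
  rewrite -(card_imset _ someI).
  apply: leq_trans (leq_imset_card (f w) _); apply: subset_leq_card.
  apply/subsetP=> _ /imsetP[c cM ->]; have := noM c; rewrite cM andbT.
  case/not_missing=> y fy; apply/imsetP; exists y => //.
  by rewrite inE; apply/exists_inP; exists c; rewrite ?fy.
have card_Y : #|Y| <= (w \in Y) + #|F| + #|X :&: Y|.
  have -> : (w \in Y) = #|[set w] :&: Y| :> nat.
    have [wY|wY] := boolP (w \in Y).
      by rewrite (setIidPl _) ?cards1 // sub1set.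
    apply/esym/eqP; rewrite cards_eq0 -subset0; apply/subsetP => y.
    by rewrite !inE => /andP[/eqP->]; rewrite inE in wY; rewrite (negPf wY).
  apply: (@leq_trans #|([set w] :&: Y) :|: F :|: (X :&: Y)|).
    apply: subset_leq_card; apply/subsetP=> y yY; rewrite !in_setU !in_setI yY.
    rewrite !andbT in_set1; have [//|y_w /=] := eqVneq y w.
    have [yX|yX] := boolP (y \in X); first by rewrite orbT.
    move: yY; rewrite !inE yX orbF => /exists_inP[c cM fwy].
    apply/andP; split; last by apply/exists_inP; exists c.
    have := dom w y; rewrite (eqP fwy) [w == y]eq_sym (negPf y_w) orbF.
    by case/esym/andP.
  apply: leq_trans (leq_card_setU _ _) _; rewrite leq_add2r.
  exact: leq_card_setU.
have [/andP[wY noX]|] := boolP ((w \in Y) && [forall x in X, f x x != Some a]).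
  left; move: wY; rewrite inE => /exists_inP[c cM /eqP fww].
  apply: (coloured_but_recolour_w st aw fww cM) => x xX.
  by apply/eqP; apply: (forall_inP noX).
rewrite negb_and => wX.
(* If [w] is in [Y], some vertex of [X] is coloured [a], which makes [A] a proper subset. *)
have card_A : (w \in Y) + #|A| <= k.
  apply: leq_trans card_X; have AX : A \subset X.
    by apply/subsetP => x; rewrite inE => /andP[].
  case/orP: wX => [/negPf->|]; first exact: subset_leq_card.
  rewrite negb_forall => /existsP[x]; rewrite negb_imply negbK => /andP[xX fxx].
  apply: leq_trans (proper_card (_ : A \proper X)).
    by rewrite -add1n leq_add2r leq_b1.
  by apply/properP; split=> //; exists x; rewrite // inE xX fxx.
have card_u : #|[set y | f u y]| < k.
  apply: leq_trans (deg_U uU); apply: proper_card; apply/properP; split.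
    apply/subsetP => y; rewrite !inE dom uU andbF orbF.
    by case/andP.
  exists w; first by rewrite inE e_sym U_adj.
  by rewrite inE (pc_sym pc) fwu.
have := card_missing f u; rewrite -/M => card_CM.
have card_XY : #|X :&: Y| <= k.
  by apply: leq_trans card_X; apply/subset_leq_card/subsetIl.
right; split.
  (* At most k - 1 colours occur at [u], and [w] and [F] account for at most k - 1 elements of [Y].
     Thus 3k - 2 colours force at least k elements in [X :&: Y], while [X] has at most k. *)
  have XY : X :&: Y = X.
    by apply/eqP; rewrite eqEcard subsetIl /=; lia.
  move=> x; rewrite -XY !inE => /andP[_ /exists_inP[c cM /eqP fwx]].
  by exists c.
(* The same count, allowing 1 for [w] and k for [X], leaves at least k - 2 elements for [F]. *)
have /card_gt0P[u'] : 0 < #|F| by lia.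
move=> u'F; have [x xX fx] : exists2 x, x \in X & f u' x = Some a.
  by apply: edge_a; rewrite in_setU1 u'F orbT.
move: u'F; rewrite inE => /andP[u'U /exists_inP[c cM /eqP fwu']].
by exists u', x, c.
Qed.

Lemma coloured_but_complete f u : coloured_but f u ->
  exists g : V -> V -> option C, coloured_except e U g.
Proof.
move=> st; case: (st) => pc uU dom.
have [a aw] : exists a, a \in missing f w.
  apply/card_gt0P; have := card_missing f w.
  suff : #|[set y | f w y]| <= #|[set y | e w y]|.
    by move: deg_w; lia.
  have wu := U_adj uU.
  (* The colour of [w] takes the place of the uncoloured edge [w u], so fewer than [#|C|] colours
     occur at [w]. *)
  have -> : #|[set y | e w y]| = #|w |: ([set y | e w y] :\ u)|.
    rewrite cardsU1 !inE e_irr andbF /= (cardsD1 u [set y | e w y]).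
    by rewrite inE wu.
  apply: subset_leq_card; apply/subsetP => y.
    rewrite !inE dom /delete_edge !eqxx.
  case/orP=> [/andP[-> /norP[/= yu _]]|/andP[/eqP->]]; last by rewrite eqxx.
  by rewrite yu orbT.
have [//|[tight [u' [x [c [u'U xX fx fwu' cu]]]]]] := coloured_but_tight st aw.
have [g [st' sub_w gX miss_u']] := coloured_but_shift st u'U fwu' cu.
have [//|[tight' _]] := coloured_but_tight st' (subsetP sub_w _ aw).
have [m fwx mu] := tight x xX.
have u'u : u' != u.
  by apply: contra_eq_neq fwu' => ->; rewrite (coloured_but_wu st).
apply: (coloured_but_swap st aw u'U u'u xX fx fwx mu).
(* The shift kept the colour [m] of [w x], so [m] is missing at [u'] in [g]. It differs from [c],
   the colour of [w u'], hence is already missing there in [f]. *)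
have [m' gwx] := tight' x xX; rewrite gX // fwx in gwx; case: gwx => <-.
rewrite miss_u' => /setU1P[mc|//].
move: fwx; rewrite mc => fwx; have := pc_inj pc fwu' fwx => E.
by have := X_neq_U xX u'U; rewrite E eqxx.
Qed.

End Recolouring.

(** * Induction on the number of edges *)

(** Stated for all subgraphs [e] of [G] with one fixed decomposition: bounds on bags and degrees,
    unlike exact values of treewidth and maximum degree, survive edge deletion. *)
Lemma tree_decomposition_colouring (G : sgraph) (D : tree_decomposition G)
    (C : finType) (k : nat) (e : rel G) :
    3 <= k -> (forall t : td_tree D, #|td_bag t| <= k.+1) ->
    3 * k - 2 <= #|C| ->
    symmetric e -> irreflexive e -> subrel e (@sedge G) ->
    (forall x, #|[set y | e x y]| < #|C|) ->
  exists g : G -> G -> option C, coloured_except e set0 g.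
Proof.
move=> k_ge3 card_bag card_C.
have [top [d [in_top top_share]]] := td_top D.
have [n] := ubnP #|[set p : G * G | e p.1 p.2]|.
elim: n e => // n IHn e; rewrite ltnS => en sym irr sub deg.
have IH u v : e u v -> exists g : G -> G -> option C,
    coloured_except (delete_edge e u v) set0 g.
  move=> uv; apply: IHn.
  - apply: leq_trans en; apply: proper_card; apply/properP; split.
      by apply/subsetP => p; rewrite !inE => /andP[].
    by exists (u, v); rewrite !inE // /delete_edge /= !eqxx andbF.
  - exact: delete_edge_sym.
  - by move=> x; rewrite /delete_edge irr.
  - by move=> x y /andP[/sub].
  - move=> x; apply: leq_ltn_trans (deg x); apply: subset_leq_card.
    by apply/subsetP => y; rewrite !inE => /andP[].
pose dg x := #|[set y | e x y]|.
have [/existsP[u /existsP[v /and3P[uv du duv]]]|low] := boolP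
    [exists u, exists v, [&& e u v, 2 * dg u < #|C| & dg u + dg v <= #|C|]].
  by have [g col] := IH u v uv; apply: (colour_low_edge sym irr uv du duv col).
have big u v : e u v -> 2 * dg u < #|C| -> #|C| <= 2 * dg v.
  move=> uv du; move: low; rewrite negb_exists => /forallP/(_ u).
  rewrite negb_exists => /forallP/(_ v); rewrite uv du /= -ltnNge.
  have sum_gt a b c : 2 * a < c -> c < a + b -> c <= 2 * b by lia.
  exact: sum_gt du.
have [/existsP[w0 w0_big]|small] :=
  boolP [exists w, #|C| <= 2 * dg w]; last first.
  (* Every edge has an end of large degree, so here there are no edges and one colour serves all
     vertices. *)
  have /card_gt0P[c _] : 0 < #|C| by lia.
  have no_edge x y : e x y = false.
    apply/negP => exy; case/existsP: small.
    case: (leqP #|C| (2 * dg x)) => [|dx]; first by exists x.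
    by exists y; apply: big exy dx.
  exists (fun x y => if x == y then Some c else None); split; last first.
    by move=> x y; rewrite no_edge in_set0 andbT; case: eqP.
  split=> [x y|x y z c'|x y c']; first by rewrite eq_sym.
    by do 2 case: eqP => // <-.
  by rewrite no_edge.
case: (@arg_maxnP _ w0 (fun w => #|C| <= 2 * dg w) d w0_big) => w w_big w_max.
pose X := td_bag (top w) :\ w.
have U_adj u : u \in [set u | e w u] :\: X -> e w u.
  by rewrite !inE => /andP[].
(* Some bag contains both [w] and [u]; if [u] were no deeper than [w], it would lie in the bag at
   [top w], hence in [X]. *)
have U_deep u : u \in [set u | e w u] :\: X -> d w < d u.
  move=> uU; have wu := U_adj u uU; rewrite ltnNge; apply/negP => du.
  have [s /andP[ws us]] := td_edge D (sub _ _ wu).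
  move: uU; rewrite !inE (top_share s) // wu !andbT negbK.
  by apply/negP; apply: contraTneq wu => ->; rewrite irr.
have U_small u : u \in [set u | e w u] :\: X -> 2 * dg u < #|C|.
  move/U_deep=> dwu; rewrite ltnNge; apply/negP => /w_max du.
  by have := leq_trans dwu du; rewrite ltnn.
(* A neighbour [y] of [u] has large degree, so by the choice of [w] it is no deeper than [w], and
   hence than [u]. *)
have U_top u y : u \in [set u | e w u] :\: X -> e u y -> y \in td_bag (top u).
  move=> uU uy; have [s /andP[us ys]] := td_edge D (sub _ _ uy).
  apply: (top_share s) => //; apply: leq_trans (ltnW (U_deep u uU)).
  by apply: w_max; apply: big uy (U_small u uU).
(* The bag at [top u] contains both [w] and [y], and [y] is no deeper than [w]. *)
have nbr_U u y : u \in [set u | e w u] :\: X -> e u y -> y \in w |: X.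
  move=> uU uy; rewrite !inE; case: eqVneq => //= _.
  apply: (top_share (top u)); rewrite ?U_top // 1?sym ?U_adj //.
  by apply: w_max; apply: big uy (U_small u uU).
have deg_U u : u \in [set u | e w u] :\: X -> dg u <= k.
  move=> uU; rewrite -ltnS; apply: leq_trans (card_bag (top u)).
  apply: proper_card; apply/properP; split.
    by apply/subsetP => y; rewrite inE; apply: U_top.
  by exists u; rewrite ?in_top // inE irr.
have card_X : #|X| <= k.
  by have := card_bag (top w); rewrite (cardsD1 w) in_top.
have w_X : w \notin X by rewrite !inE eqxx.
(* Twice the degree of [w] is at least 3k - 2, which exceeds 2k for k at least 3; so [X] cannot
   contain all neighbours. *)
have /card_gt0P[u uU] : 0 < #|[set u | e w u] :\: X|.
  have := cardsID X [set u | e w u].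
  have := subset_leq_card (subsetIr [set u | e w u] X).
  by move: w_big; rewrite /dg; lia.
have [g col] := IH w u (U_adj u uU).
have col' : coloured_except (delete_edge e u w) set0 g.
  case: col => -[gs gi gv] dom; split=> [|x y]; last first.
    by rewrite dom delete_edgeC.
  by split=> // x y c; rewrite delete_edgeC; apply: gv.
have [f [pc dom]] := uncolour_vertices sym irr uU col'.
have [|h colh] := @coloured_but_complete G C e w X k sym irr w_X nbr_U deg_U
    card_X (deg w) k_ge3 card_C f u.
  by split=> // x y; rewrite dom delete_edgeC.
exact: (colour_vertices sym irr colh U_small).
Qed.

(** * From partial colourings to the total chromatic number *)

Lemma set2_inj (T : finType) (a b x y : T) :
  [set a; b] = [set x; y] -> (a = x /\ b = y) \/ (a = y /\ b = x).
Proof.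
move=> E; have: a \in [set x; y] by rewrite -E set21.
have: b \in [set x; y] by rewrite -E set22.
have: x \in [set a; b] by rewrite E set21.
have: y \in [set a; b] by rewrite E set22.
rewrite !in_set2.
by do 4 (case/orP=> /eqP ?); subst; auto.
Qed.

Lemma coloured_total_colorable (G : sgraph) m (g : G -> G -> option 'I_m) :
  coloured_except (@sedge G) set0 g -> 0 < m -> total_colorable G m.
Proof.
case=> pc dom m_gt0; pose c0 := Ordinal m_gt0.
have vertexP x : exists c, g x x = Some c.
  by have := dom x x; rewrite eqxx inE orbT; case: (g x x) => // c; exists c.
pose cv := [ffun x => odflt c0 (g x x)].
have cvP x : g x x = Some (cv x).
  by have [c gx] := vertexP x; rewrite ffunE gx.
(* An edge is an unordered pair, so an ordering of its ends is picked; by symmetry any will do. The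
   default [c0] is never reached. *)
pose ce := [ffun E : edge G => odflt c0 (obind (fun p => g p.1 p.2)
  [pick p : G * G | (p.1 -- p.2) && (val E == [set p.1; p.2])])].
have ceP (E : edge G) : exists x y,
    [/\ x -- y, val E = [set x; y] & g x y = Some (ce E)].
  have /imsetP[[x y]] := valP E; rewrite inE /= => xy Exy.
  rewrite ffunE; case: pickP => [[a b] /= /andP[ab /eqP Eab]|].
    exists a, b; split=> //; have := dom a b; rewrite ab.
    by case: (g a b).
  by move/(_ (x, y)); rewrite /= xy Exy eqxx.
have ce_at (E : edge G) x : x \in val E ->
    exists y, [/\ x -- y, val E = [set x; y] & g x y = Some (ce E)].
  have [a [b [ab -> gab]]] := ceP E; rewrite in_set2 => /orP[/eqP->|/eqP->].
    by exists b.
  by exists a; rewrite sedge_sym setUC (pc_sym pc).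
apply/existsP; exists cv; apply/existsP; exists ce; apply/and3P; split.
- apply/forallP => x; apply/forallP => y; apply/implyP => xy.
  by apply/eqP => cxy; apply: (pc_vertex pc xy (cvP x)); rewrite cvP cxy.
- apply/forallP => E; apply/forallP => F; apply/implyP => /andP[EF].
  rewrite -setI_eq0 => /set0Pn[x /setIP[xE xF]].
  have [y [_ Exy gy]] := ce_at E x xE; have [z [_ Fxz gz]] := ce_at F x xF.
  apply: contraNneq EF => c_EF; apply/eqP/val_inj; rewrite Exy Fxz.
  by rewrite -c_EF in gz; rewrite (pc_inj pc gy gz).
- apply/forallP => x; apply/forallP => E; apply/implyP => xE.
  have [y [xy _ gy]] := ce_at E x xE; apply: contraTneq xy => cxE.
  by move: gy; rewrite -cxE => /(pc_inj pc (cvP x)) <-; rewrite sedge_irr.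
Qed.

(** The edges at [x] have distinct colours, all different from that of [x]. *)
Lemma total_colorable_degree (G : sgraph) m (x : G) :
  total_colorable G m -> #|[set y | x -- y]| < m.
Proof.
case/existsP=> cv /existsP[ce /and3P[_ /forallP ceP /forallP cveP]].
have edgeP y : x -- y -> [set x; y] \in edges G.
  by move=> xy; apply/imsetP; exists (x, y); rewrite ?inE.
pose h y := oapp ce (cv x) (insub [set x; y]).
have hE y : y \in [set y | x -- y] ->
    exists2 E : edge G, val E = [set x; y] & h y = ce E.
  rewrite inE => /edgeP xy; exists (Sub [set x; y] xy); rewrite ?SubK //.
  by rewrite /h insubT.
rewrite -[m in _ < m]card_ord -(card_in_imset (f := h)) => [|y z yN zN].
  rewrite -[X in X < _]/(0 + _) -(cardsT 'I_m).
  apply: proper_card; apply/properP; split; first exact: subsetT.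
  exists (cv x) => //; apply/negP => /imsetP[y /hE[E Exy ->]] /eqP.
  apply/negP; apply: (implyP (forallP (cveP x) E)).
  by rewrite Exy set21.
have [E Ey ->] := hE _ yN; have [F Fz ->] := hE _ zN => cEF.
have /eqP EF : E == F.
  have := forallP (ceP E) F; apply: contraLR => EF; rewrite EF /=.
  rewrite cEF eqxx implybF negbK -setI_eq0; apply/set0Pn.
  by exists x; rewrite inE Ey Fz !set21.
move: yN; rewrite EF Fz in Ey; case/set2_inj: Ey => -[//].
by move=> -> ->; rewrite inE.
Qed.

Theorem theorem2 (k : nat) (G : sgraph) (hk : 3 <= k)
  (htw : has_treewidth G k) (hdeg : 3 * k - 3 <= max_degree G) :
  total_chromatic_number G = max_degree G + 1.
Proof.
case: htw => -[D widthD] _.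
have card_bag (t : td_tree D) : #|td_bag t| <= k.+1.
  have := leq_bigmax (F := fun t => #|@td_bag G D t|) t.
  by move: widthD; rewrite /width; lia.
have degG (x : G) : #|[set y | x -- y]| <= max_degree G.
  exact: (leq_bigmax (F := fun x : G => #|[set y | x -- y]|)).
have [g col] : exists g : G -> G -> option 'I_(max_degree G + 1),
    coloured_except (@sedge G) set0 g.
  apply: (tree_decomposition_colouring hk card_bag) => [|||//|x].
  all: rewrite ?card_ord.
  - by move: hdeg; lia.
  - exact: sedge_sym.
  - exact: sedge_irr.
  - by rewrite addn1 ltnS.
rewrite /total_chromatic_number; case: ex_minnP => m col_m min_m.
apply/eqP; rewrite eqn_leq min_m ?(coloured_total_colorable col) ?addn1 //=.
(* The maximum is attained because [G] has a vertex: otherwise the maximum degree would be 0, below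
   3k - 3. *)
have [x ->] : exists x : G, max_degree G = #|[set y | x -- y]|.
  case: (posnP #|G|) => [G0|G_gt0].
    move: hdeg; rewrite /max_degree big_pred0 => [|x]; first by lia.
    by have := fintype0 x.
  have [x max_x] := eq_bigmax (fun x : G => #|[set y | x -- y]|) G_gt0.
  by exists x; apply: max_x.
exact: total_colorable_degree.
Qed.
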